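(* Let $1<p\in\mathbb{R}$ and let $G$ and $H$ be finitely generated groups. If there is a rough isometry from $G$ to $H$, then the $p$-harmonic boundary $\partial_p(G)$ is homeomorphic to the $p$-harmonic boundary $\partial_p(H)$.
   Context: Finitely generated groups are equipped with the word metric of a finite symmetric generating set: the distance between two elements is the length of the shortest path between them in the Cayley graph, in which $g_1,g_2$ are joined by an edge if and only if $g_1=g_2s^{\pm1}$ for some generator $s$. A map $\phi:X\to Y$ between metric spaces $(X,d_X)$, $(Y,d_Y)$ is a rough isometry if (1) there are constants $a\ge 1$, $b\ge 0$ such that $\frac1a d_X(x_1,x_2)-b\le d_Y(\phi(x_1),\phi(x_2))\le a\,d_X(x_1,x_2)+b$ for all $x_1,x_2\in X$, and (2) there is a constant $c>0$ such that for each $y\in Y$ there is $x\in X$ with $d_Y(\phi(x),y)<c$. Let $G$ be a finitely generated group with identity $e_G$ and finite symmetric generating set $S$. $D_p(G)$ is the set of functions $f:G\to\mathbb{C}$ with $\sum_{g\in G}|f(gs^{-1})-f(g)|^p<\infty$ for all $s\in S$, with pseudonorm $\|f\|=\left(\sum_{s\in S}\sum_{g\in G}|f(gs^{-1})-f(g)|^p\right)^{1/p}$ and Banach norm $\|f\|_{D_p}=(\|f\|^p+|f(e_G)|^p)^{1/p}$. For $A\subseteq D_p(G)$, $(\overline{A})_{D_p}$ is the closure of $A$ in $D_p(G)$. $\mathbb{C}G$ is the set of finitely supported functions on $G$. $BD_p(G)$ is the set of bounded functions in $D_p(G)$; it is a commutative Banach algebra under pointwise operations with norm $\|f\|_{BD_p}=\|f\|_\infty+\|f\|$.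 $Sp(BD_p(G))$ is the set of characters (nonzero algebra homomorphisms $BD_p(G)\to\mathbb{C}$), with the weak-$*$ topology; it is a compact Hausdorff space. For $f\in BD_p(G)$, $\hat f(\tau)=\tau(f)$. $G$ is identified with its image under the injection $i:G\to Sp(BD_p(G))$, $(i(g))(f)=f(g)$. $B(\overline{\mathbb{C}G})_{D_p}$ is the set of bounded functions in $(\overline{\mathbb{C}G})_{D_p}$. The $p$-harmonic boundary is $\partial_p(G)=\{x\in Sp(BD_p(G))\setminus G : \hat f(x)=0 \text{ for all } f\in B(\overline{\mathbb{C}G})_{D_p}\}$, with the subspace topology. *)

(* Defs.v *)
From HB Require Import structures.
From mathcomp Require Import all_boot all_order all_algebra finmap complex.
From mathcomp Require Import all_classical all_reals all_analysis.

Set Implicit Arguments.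
Unset Strict Implicit.
Unset Printing Implicit Defensive.

Import Order.TTheory GRing.Theory Num.Theory.
Import numFieldNormedType.Exports.
Import ComplexField.Normc.

Local Open Scope classical_set_scope.
Local Open Scope ring_scope.

Section RoughIsometry.
Context {R : realType} {X Y : Type}.

Definition rough_isometry (dX : X -> X -> R) (dY : Y -> Y -> R)
    (phi : X -> Y) : Prop :=
  (exists a b : R, [/\ 1 <= a, 0 <= b &
     forall x1 x2, a^-1 * dX x1 x2 - b <= dY (phi x1) (phi x2)
                                       <= a * dX x1 x2 + b]) /\
  (exists2 c : R, 0 < c & forall y, exists x, dY (phi x) y < c).

End RoughIsometry.

Definition homeomorphic (X Y : topologicalType) : Prop :=
  exists (f : X -> Y) (g : Y -> X),
    [/\ continuous f, continuous g, cancel f g & cancel g f].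

Section WordMetric.
Context {G : groupType}.
Implicit Types S : {fset G}.

Definition generates S : Prop :=
  forall K : {pred G}, group_closed K -> {subset S <= K} -> forall g, g \in K.

Definition symmetric_generating S : Prop :=
  (forall s, s \in S -> s^-1%g \in S) /\ generates S.

Definition cayley_edge S : rel G := fun g1 g2 =>
  has (fun s => (g1 == g2 * s)%g || (g1 == g2 * s^-1)%g) S.

(* [inf] is the minimum of the set of lengths whenever [y] can be reached
   from [x], and hence for all [x] and [y] when [S] generates [G]. *)
Definition word_dist (R : realType) S (x y : G) : R :=
  inf [set (size w)%:R | w in [set w | path (cayley_edge S) x w
                                       /\ last x w = y]].

End WordMetric.

Section DirichletSpace.
Context {R : realType} {G : groupType}.
Local Notation C := R[i].
Variables (p : R) (S : {fset G}).
Implicit Types (f : G -> C) (A : set (G -> C)).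

Definition diff_psum (s : G) f : \bar R :=
  \esum_(g in [set: G]) (normc (f (g * s^-1)%g - f g) `^ p)%:E.

Definition Dp : set (G -> C) :=
  [set f | forall s, s \in S -> (diff_psum s f < +oo)%E].

(* The two norms are extended-real valued so as to be meaningful for every
   function; they are finite on [Dp]. *)
Definition Dp_seminorm f : \bar R :=
  ((\sum_(s <- S) diff_psum s f) `^ p^-1)%E.

Definition Dp_norm f : \bar R :=
  ((Dp_seminorm f `^ p + (normc (f 1%g) `^ p)%:E) `^ p^-1)%E.

Definition Dp_closure A : set (G -> C) :=
  [set f | Dp f /\ forall e : R, 0 < e ->
             exists2 h, A h & (Dp_norm (f - h)%R < e%:E)%E].

Definition finite_support : set (G -> C) :=
  [set f | finite_set (f @^-1` [set~ 0])].

Definition bounded_function : set (G -> C) :=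
  [set f | exists M : R, forall g, normc (f g) <= M].

End DirichletSpace.

Lemma normc_ge0 (R : rcfType) (z : R[i]) : 0 <= normc z.
Proof. by case: z => ? ?; exact: sqrtr_ge0. Qed.

Section BoundedDirichlet.
Context {R : realType} {G : groupType}.
Local Notation C := R[i].
Variable p : R.

(* The proof argument makes the algebra structure of [BDp] below inferable. *)
Definition BDp_pred (p1 : 1 < p) (S : {fset G}) : {pred G -> C} :=
  mem (Dp p S `&` bounded_function).

Variables (p1 : 1 < p) (S : {fset G}).

Lemma esum_mulrn_lty (T : choiceType) (a : T -> \bar R) (n : nat) :
  (forall t, 0 <= a t)%E -> (\esum_(t in [set: T]) a t < +oo)%E ->
  (\esum_(t in [set: T]) (\sum_(i < n) a t) < +oo)%E.
Proof.
move=> a0 afin; rewrite esum_sum; last by move=> *; exact: a0.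
by apply/lte_sum_pinfty.
Qed.

Lemma diff_psum_lty_le (s : G) (f u v : G -> C) (M : R) :
  (forall g, normc (f (g * s^-1)%g - f g) <=
     M * (normc (u (g * s^-1)%g - u g) + normc (v (g * s^-1)%g - v g))) ->
  (diff_psum p s u < +oo -> diff_psum p s v < +oo -> diff_psum p s f < +oo)%E.
Proof.
have p0 : 0 < p by exact: lt_trans p1.
move=> fM ufin vfin.
pose d (h : G -> C) g := normc (h (g * s^-1)%g - h g).
have d0 h g : 0 <= d h g by exact: normc_ge0.
pose N := Num.trunc ((2 * `|M|) `^ p).
have fK g : d f g `^ p <= \sum_(i < N.+1) (d u g `^ p + d v g `^ p).
  rewrite sumr_const card_ord -mulr_natl.
  have mx0 : 0 <= Num.max (d u g) (d v g) by rewrite le_max d0.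
  have fmx : d f g <= 2 * `|M| * Num.max (d u g) (d v g).
    apply: (le_trans (fM g)); rewrite -/(d u g) -/(d v g).
    apply: (@le_trans _ _ (`|M| * (d u g + d v g))).
      by rewrite ler_wpM2r ?addr_ge0// ler_norm.
    rewrite (mulrC 2) -mulrA ler_wpM2l// mulr_natl mulr2n.
    by rewrite lerD// le_max lexx ?orbT.
  apply: (@le_trans _ _ ((2 * `|M| * Num.max (d u g) (d v g)) `^ p)).
    by apply: ge0_ler_powR => //; rewrite ?nnegrE ?(ltW p0)// !mulr_ge0.
  rewrite powRM ?mulr_ge0//; apply: ler_pM; rewrite ?powR_ge0//.
    by rewrite ltW// truncnS_gt.
  case: (leP (d u g) (d v g)) => _; first by rewrite lerDr powR_ge0.
  by rewrite lerDl powR_ge0.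
apply: (@le_lt_trans _ _ (\esum_(g in [set: G]) (\sum_(i < N.+1)
    ((d u g `^ p)%:E + (d v g `^ p)%:E)))%E).
  apply: le_esum => g _; rewrite -/(d f g).
  under eq_bigr do rewrite -EFinD.
  by rewrite sumEFin lee_fin fK.
apply: esum_mulrn_lty; first by move=> g; rewrite -EFinD lee_fin addr_ge0// powR_ge0.
rewrite esumD => [|g _|g _]; rewrite ?lee_fin ?powR_ge0//.
exact: lte_add_pinfty.
Qed.

Lemma BDp_pred_subring : subring_closed (BDp_pred p1 S).
Proof.
split.
- rewrite inE; split=> [s _|].
    rewrite /diff_psum esum1// => g _.
    by rewrite subrr normc0 powR0// gt_eqF// (lt_trans _ p1).
  by exists 1 => g; rewrite normc1.
- move=> f h /[!inE] -[fD [a fa]] [hD [b hb]]; split=> [s sS|].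
    apply: (@diff_psum_lty_le s (f - h) f h 1 _ (fD s sS) (hD s sS)) => g.
    have -> : (f - h) (g * s^-1)%g - (f - h) g =
        (f (g * s^-1)%g - f g) + - (h (g * s^-1)%g - h g).
      rewrite !opprB addrACA [RHS]addrACA; congr (_ + _).
      by rewrite addrC.
    rewrite mul1r.
    by rewrite (le_trans (le_normcD _ _))// normcN.
  exists (a + b) => g; rewrite (le_trans (le_normcD _ _))// normcN.
  exact: lerD.
- move=> f h /[!inE] -[fD [a fa]] [hD [b hb]].
  have a0 := le_trans (normc_ge0 _) (fa 1%g).
  have b0 := le_trans (normc_ge0 _) (hb 1%g).
  split=> [s sS|].
    apply: (@diff_psum_lty_le s (f * h) f h (a + b) _ (fD s sS) (hD s sS)) => g.
    rewrite (_ : _ - _ = (f (g * s^-1)%g - f g) * h (g * s^-1)%g +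
      f g * (h (g * s^-1)%g - h g)); last first.
      by rewrite mulrBl mulrBr addrA subrK.
    rewrite (le_trans (le_normcD _ _))// !normcM mulrDr lerD//.
      by rewrite mulrC ler_wpM2r ?normc_ge0// (le_trans (hb _))// lerDr.
    by rewrite ler_wpM2r ?normc_ge0// (le_trans (fa _))// lerDl.
  exists (a * b) => g; rewrite normcM; apply: ler_pM => //; exact: normc_ge0.
Qed.

Lemma BDp_pred_scale : GRing.scaler_closed (BDp_pred p1 S).
Proof.
move=> k f /[!inE] -[fD [a fa]]; split=> [s sS|].
  apply: (@diff_psum_lty_le s (k *: f) f f (normc k) _ (fD s sS) (fD s sS)) => g.
  by rewrite -mulrBr normcM ler_wpM2l ?normc_ge0// lerDl normc_ge0.
by exists (normc k * a) => g; rewrite normcM ler_wpM2l ?normc_ge0.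
Qed.

HB.instance Definition _ := GRing.isSubringClosed.Build _ (BDp_pred p1 S)
  BDp_pred_subring.
HB.instance Definition _ := GRing.isScaleClosed.Build _ _ (BDp_pred p1 S)
  BDp_pred_scale.

Record BDp := MkBDp { BDp_fun :> G -> C; _ : BDp_fun \in BDp_pred p1 S }.

HB.instance Definition _ := [isSub for BDp_fun].
HB.instance Definition _ := [Choice of BDp by <:].
HB.instance Definition _ := GRing.SubChoice_isSubComPzRing.Build _ _ BDp
  BDp_pred_subring.
HB.instance Definition _ := [SubZmodule_isSubLmodule of BDp by <:].

Lemma BDp_oner_neq0 : 1 != 0 :> BDp.
Proof.
apply/eqP => /(congr1 (fun f : BDp => f 1%g)).
by move/eqP; rewrite oner_eq0.
Qed.

HB.instance Definition _ := GRing.PzSemiRing_isNonZero.Build BDp BDp_oner_neq0.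

Lemma BDp_scalerAl (k : C) (f h : BDp) : k *: (f * h) = (k *: f) * h.
Proof. by apply/val_inj/funext => g /=; exact: mulrA. Qed.

HB.instance Definition _ := GRing.Lmodule_isLalgebra.Build C BDp BDp_scalerAl.
HB.instance Definition _ := GRing.Lalgebra_isComAlgebra.Build C BDp.

(* The topology of pointwise convergence on [BDp -> C] induces the weak-*
   topology on the characters. [C^o] carries the norm topology of [C]. *)
Definition Sp : set {ptws BDp -> C^o} :=
  [set tau | [/\ scalar tau, {morph tau : f h / f * h} &
                 exists f : BDp, tau f != 0]].

Lemma eval_Sp (g : G) : Sp (fun f : BDp => f g).
Proof. by split=> //; exists 1; exact: oner_neq0. Qed.

Definition point (g : G) : Sp := SigSub (mem_set (eval_Sp g)).

Definition gelfand (f : BDp) (tau : Sp) : C := \val tau f.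

Definition harmonic_boundary : set Sp :=
  ~` range point `&`
  [set x | forall f : BDp,
     Dp_closure p S finite_support f -> gelfand f x = 0].

End BoundedDirichlet.

Arguments BDp {R G p} p1 S.
Arguments Sp {R G p} p1 S.
Arguments point {R G p} p1 S g.
Arguments harmonic_boundary {R G p} p1 S.

(* Main.v *)
(* A rough isometry phi : G -> H and a rough inverse psi move points at bounded displacement to
   points at bounded displacement and have fibres of bounded size.  Hence composition with phi
   is a unital algebra morphism BD_p(H) -> BD_p(G) that is bounded for the D_p norms and
   preserves finite support, so it maps the closure of CH into the closure of CG; dually,
   characters in the boundary of G pull back to characters in the boundary of H.  Since psi o phi
   is at bounded distance from the identity, f o psi o phi - f is p-summable for f in D_p(G),
   hence lies in the closure of CG, where boundary characters vanish: the two dual maps are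
   mutually inverse. *)
Require Import Defs.
From mathcomp Require Import all_boot all_order all_algebra finmap complex.
From mathcomp Require Import all_classical all_reals all_analysis.

Set Implicit Arguments.
Unset Strict Implicit.
Unset Printing Implicit Defensive.

Import Order.TTheory GRing.Theory Num.Theory.
Import numFieldNormedType.Exports.
Import ComplexField.Normc.

Local Open Scope ring_scope.

(** * Displacements along paths in the Cayley graph *)

Section CayleyGraph.
Context {G : groupType} (S : {fset G}).
Implicit Types (x y g : G) (w : seq G).

(** Induction on the length: the first edge has displacement a generator or its inverse, and the
    displacements of successive edges multiply. *)
Lemma cayley_path_finite (n : nat) : exists F : seq G,
  forall x w, (size w < n)%N -> path (cayley_edge S) x w ->
    (x^-1 * last x w)%g \in F.
Proof.
elim: n => [|n [F HF]]; first by exists [::].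
pose E := [seq s^-1%g | s <- S] ++ S.
exists (1%g :: [seq (s * b)%g | s <- E, b <- F]) => x [|y w] /=.
  by rewrite mulVg mem_head.
move=> wn /andP[/hasP[s sS xy]] /(HF y w wn) yF.
rewrite inE; apply/orP; right; apply/allpairsP.
exists ((x^-1 * y)%g, (y^-1 * last y w)%g); split => //=; last first.
  by rewrite mulgA mulgK.
rewrite mem_cat; case/orP: xy => /eqP ->.
  by rewrite invgM mulgVK; apply/orP; left; exact: map_f.
by rewrite invgM mulgVK invgK; apply/orP; right.
Qed.

(** Edges are invariant under left translation, so the length [n] can be chosen independently of the
    starting point [x]; this uniformity is what bounds distances below. *)
Lemma cayley_path_exists (g : G) : generates S ->
  exists n : nat, forall x, exists w,
    [/\ size w = n, path (cayley_edge S) x w & last x w = (x * g)%g].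
Proof.
move=> genS.
pose reach g := exists n : nat, forall x, exists w,
  [/\ size w = n, path (cayley_edge S) x w & last x w = (x * g)%g].
have reachM u v : reach u -> reach v -> reach (u * v)%g.
  move=> [n un] [m vm]; exists (n + m)%N => x.
  have [w1 [w1n p1 l1]] := un x; have [w2 [w2m p2 l2]] := vm (x * u)%g.
  exists (w1 ++ w2).
  by rewrite size_cat w1n w2m cat_path p1 last_cat l1 p2 l2 mulgA.
have reach1 : reach 1%g.
  by exists 0%N => x; exists [::]; rewrite mulg1.
have reach_edge u : (forall x, cayley_edge S x (x * u)%g) -> reach u.
  by move=> eu; exists 1%N => x; exists [:: (x * u)%g]; rewrite /= eu.
(* Closure is required under [u * v^-1], hence the condition on both [g] and its inverse. *)
pose K : {pred G} := [pred g | `[< reach g /\ reach g^-1%g >]].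
suff /(genS K) gK : group_closed K.
  have /gK /(_ g) /asboolP[] // : {subset S <= K}.
  move=> s sS; apply/asboolP; split; apply: reach_edge => x; apply/hasP; exists s => //.
    by rewrite mulgK eqxx orbT.
  by rewrite mulgVK eqxx.
split; first by apply/asboolP; rewrite invg1.
move=> u v /asboolP[u1 u2] /asboolP[v1 v2]; apply/asboolP.
by rewrite invgM invgK; split; apply: reachM.
Qed.

Variable R : realType.

Lemma word_dist_finite (r : R) : generates S ->
  exists F : seq G, forall x y, word_dist R S x y <= r -> (x^-1 * y)%g \in F.
Proof.
move=> genS.
have [F HF] := cayley_path_finite (Num.trunc (r + 1)).+1; exists F => x y xyr.
(* The slack 1 makes the bound on the infimum strict, which yields an actual path of length below
   [r + 1]. *)
have : word_dist R S x y < r + 1 by rewrite (le_lt_trans xyr)// ltrDl.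
case/inf_lt.
  have [n /(_ x)[w [_ pw lw]]] := cayley_path_exists (x^-1 * y)%g genS.
  by exists (size w)%:R, w => //; split=> //; rewrite lw mulVKg.
move=> _ [w [pw <-] <-] wr.
apply: HF => //; rewrite -(ltr_nat R).
by rewrite (lt_trans wr)// truncnS_gt.
Qed.

Lemma word_dist_bounded (F : seq G) : generates S ->
  exists r : R, forall x y, (x^-1 * y)%g \in F -> word_dist R S x y <= r.
Proof.
move=> genS; elim: F => [|g F [r Hr]]; first by exists 0.
have [n gn] := cayley_path_exists g genS.
exists (Num.max n%:R r) => x y; rewrite inE le_max => /orP[/eqP xyg|/Hr->].
  have [w [wn pw lw]] := gn x.
  rewrite ge_inf//.
    by exists 0 => _ [u _ <-].
  by exists w; rewrite ?wn//; split=> //; rewrite lw -xyg mulVKg.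
by rewrite orbT.
Qed.

End CayleyGraph.

(** * Coarse maps and rough inverses *)

Section CoarseMaps.

(* Balls of the word metric are finite, so bounding a distance d(x, y) amounts to confining the
   displacement [x^-1 * y] to a finite set. *)
Definition coarse_map {G H : groupType} (phi : G -> H) : Prop :=
  forall F : seq G, exists F' : seq H, forall x y,
    (x^-1 * y)%g \in F -> ((phi x)^-1 * phi y)%g \in F'.

(** Taking [F'] to be [[:: 1]] shows that the fibres have uniformly bounded size. *)
Definition proper_map {G H : groupType} (phi : G -> H) : Prop :=
  forall F' : seq H, exists F : seq G, forall x y,
    ((phi x)^-1 * phi y)%g \in F' -> (x^-1 * y)%g \in F.

Definition near_id {G : groupType} (theta : G -> G) : Prop :=
  exists F : seq G, forall x, ((theta x)^-1 * x)%g \in F.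

Lemma rough_isometry_coarse_inverse (R : realType) (G H : groupType)
    (S : {fset G}) (T : {fset H}) (phi : G -> H) :
  generates S -> generates T ->
  rough_isometry (word_dist R S) (word_dist R T) phi ->
  exists psi : H -> G, [/\ coarse_map phi /\ proper_map phi,
    coarse_map psi /\ proper_map psi, near_id (psi \o phi) & near_id (phi \o psi)].
Proof.
move=> genS genT [[a [b [a1 b0 ab]]] [c c0 sur]].
have a0 : 0 < a by exact: lt_le_trans a1.
have phiC : coarse_map phi.
  move=> F; have [r Hr] := word_dist_bounded R F genS.
  have [F' HF'] := word_dist_finite (a * r + b) genT.
  exists F' => x y /Hr xyr; apply: HF'.
  have /andP[_ /le_trans->//] := ab x y.
  by rewrite lerD2r ler_pM2l.
have phiP : proper_map phi.
  move=> F'; have [r Hr] := word_dist_bounded R F' genT.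
  have [F HF] := word_dist_finite (a * (r + b)) genS.
  exists F => x y /Hr xyr; apply: HF.
  have /andP[/le_trans/(_ xyr) + _] := ab x y.
  by rewrite lerBlDr ler_pdivrMl.
have [F0 HF0] := word_dist_finite c genT.
(* The rough inverse sends [h] to some point whose image lies within [c] of [h]. *)
have /choice[psi Hpsi] h : exists g, ((phi g)^-1 * h)%g \in F0.
  by have [g gc] := sur h; exists g; apply/HF0/ltW.
exists psi; split=> //.
- split=> F.
    (* The displacement from [phi (psi x)] to [phi (psi y)], taken through [x] and [y], lies in
       [F0 * F * F0^-1]; properness of [phi] then confines that from [psi x] to [psi y]. *)
    have [F' HF'] := phiP [seq (u.1 * u.2)%g | u <- allpairs pair F0
      [seq (u.1 * u.2)%g | u <- allpairs pair F [seq v^-1%g | v <- F0]]].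
    exists F' => x y xyF; apply: HF'; apply/mapP.
    exists (((phi (psi x))^-1 * x)%g, (x^-1 * phi (psi y))%g); last first.
      by rewrite /= mulgA mulgK.
    apply: allpairs_f => //; apply/mapP.
    exists ((x^-1 * y)%g, (y^-1 * phi (psi y))%g); last first.
      by rewrite /= mulgA mulgK.
    apply: allpairs_f => //; apply/mapP.
    by exists ((phi (psi y))^-1 * y)%g => //; rewrite invgM invgK.
  (* Conversely, going from [x] to [y] through [phi (psi x)] and [phi (psi y)] gives a displacement
     in [F0^-1 * F' * F0]. *)
  have [F' HF'] := phiC F.
  exists [seq (u.1 * u.2)%g | u <- allpairs pair [seq v^-1%g | v <- F0]
      [seq (u.1 * u.2)%g | u <- allpairs pair F' F0]].
  move=> x y /HF' xyF; apply/mapP.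
  exists ((x^-1 * phi (psi x))%g, ((phi (psi x))^-1 * y)%g); last first.
    by rewrite /= mulgA mulgK.
  apply: allpairs_f; apply/mapP.
    by exists ((phi (psi x))^-1 * x)%g => //; rewrite invgM invgK.
  exists (((phi (psi x))^-1 * phi (psi y))%g, ((phi (psi y))^-1 * y)%g).
    exact: allpairs_f.
  by rewrite /= mulgA mulgK.
(* The points [psi (phi x)] and [x] have images under [phi] with displacement in [F0], so properness
   applies. *)
- have [F HF] := phiP F0.
  by exists F => x; exact: HF (Hpsi _).
- by exists F0.
Qed.

End CoarseMaps.

(** * Unordered sums of nonnegative terms *)

Section ESum.
Local Open Scope classical_set_scope.
Context {R : realType}.

Lemma esumZl_le (T : choiceType) (c : R) (a : T -> \bar R) : 0 <= c ->
  (forall t, 0 <= a t)%E ->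
  (\esum_(t in [set: T]) (c%:E * a t) <= c%:E * \esum_(t in [set: T]) a t)%E.
Proof.
move=> c0 a0; apply: ge_ereal_sup => _ [X XT <-].
rewrite -ge0_mule_fsumr// lee_pmul//; first exact: fsume_ge0.
by apply: ereal_sup_ubound; exists X.
Qed.

Lemma esum_comp_inj_le (T U : choiceType) (A : set T) (phi : T -> U)
    (a : U -> \bar R) : set_inj A phi -> (forall u, 0 <= a u)%E ->
  (\esum_(t in A) a (phi t) <= \esum_(u in [set: U]) a u)%E.
Proof.
move=> phi_inj a0; rewrite -esum_image// esum_mkcond.
by apply: le_esum => u _; case: ifP.
Qed.

(** The sum is a supremum of finite partial sums; one within [e] of it leaves a tail below [e]. *)
Lemma esum_tail_lt (T : choiceType) (a : T -> \bar R) (e : R) : 0 < e ->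
  (forall t, 0 <= a t)%E -> (\esum_(t in [set: T]) a t < +oo)%E ->
  exists2 X : set T, finite_set X & (\esum_(t in ~` X) a t < e%:E)%E.
Proof.
move=> e0 a0 afin.
have afn : \esum_(t in [set: T]) a t \is a fin_num.
  by rewrite ge0_fin_numE// esum_ge0.
have [_ [X [finX _] <-]] := ub_ereal_sup_adherent e0 afn.
rewrite -/(esum _ _) => Xlt; exists X => //.
move: Xlt afn; rewrite (esumID X)// !setTI (@esum_fset _ _ X)//.
rewrite fin_numD => + /andP[X1 X2].
by rewrite -(fineK X1) -(fineK X2) -EFinD !lte_fin ltrBlDr ltrD2l.
Qed.

End ESum.

(** * Sums of p-th powers and of translation differences *)

Section LpSum.
Local Open Scope classical_set_scope.
Context {R : realType} (p : R).
Hypothesis p1 : 1 < p.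
Local Notation C := R[i].

Let p0 : 0 < p. Proof. exact: lt_trans p1. Qed.

Definition lp_sum (T : choiceType) (f : T -> C) : \bar R :=
  \esum_(t in [set: T]) (normc (f t) `^ p)%:E.

Lemma lp_sum_ge0 (T : choiceType) (f : T -> C) : (0 <= lp_sum f)%E.
Proof. by apply: esum_ge0 => t _; rewrite lee_fin powR_ge0. Qed.

(** The modulus of [x + y] is at most twice the larger modulus; this crude constant suffices
    throughout. *)
Lemma normc_powRD (x y : C) :
  normc (x + y) `^ p <= 2 `^ p * (normc x `^ p + normc y `^ p).
Proof.
wlog xy : x y / normc x <= normc y => [hw|].
  by case/orP: (le_total (normc x) (normc y)) => /hw//; rewrite addrC [X in _ * X]addrC.
apply: (@le_trans _ _ ((2 * normc y) `^ p)).
  rewrite ge0_ler_powR ?nnegrE ?(ltW p0) ?mulr_ge0 ?normc_ge0//.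
  by rewrite (le_trans (le_normcD _ _))// mulr_natl mulr2n lerD2r.
rewrite powRM ?normc_ge0// ler_wpM2l ?powR_ge0//.
by rewrite lerDr powR_ge0.
Qed.

Lemma lp_sumD (T : choiceType) (f g : T -> C) :
  (lp_sum (f \+ g)%R <= (2 `^ p)%:E * (lp_sum f + lp_sum g))%E.
Proof.
rewrite /lp_sum -esumD => [|t _|t _]; rewrite ?lee_fin ?powR_ge0//.
apply: le_trans (esumZl_le _ _) => [||t]; rewrite ?powR_ge0//; last first.
  by rewrite adde_ge0// lee_fin powR_ge0.
by apply: le_esum => t _; rewrite -EFinD -EFinM lee_fin normc_powRD.
Qed.

Lemma lp_sum_mulr (G : groupType) (u : G) (f : G -> C) :
  lp_sum (fun g => f (g * u)%g) = lp_sum f.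
Proof.
apply/esym; apply: (@reindex_esum _ _ _ _ _ (fun g => (g * u)%g)
  (fun g => (normc (f g) `^ p)%:E)); split=> //.
  by move=> x y _ _; exact: mulIg.
by move=> x _; exists (x * u^-1)%g; rewrite ?mulgVK.
Qed.

Lemma lp_sumN (T : choiceType) (f : T -> C) : lp_sum (fun t => - f t) = lp_sum f.
Proof. by apply: eq_esum => t _; rewrite normcN. Qed.

(** Telescoping through [f (g * v^-1)], with right translation leaving the sum of the first
    difference unchanged. *)
Lemma diff_psumM (G : groupType) (u v : G) (f : G -> C) :
  (diff_psum p (u * v)%g f <= (2 `^ p)%:E * (diff_psum p u f + diff_psum p v f))%E.
Proof.
pose du g := f (g * u^-1)%g - f g; pose dv g := f (g * v^-1)%g - f g.
have -> : diff_psum p (u * v)%g f = lp_sum ((fun g => du (g * v^-1)%g) \+ dv)%R.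
  by apply: eq_esum => g _; rewrite /du /dv /= addrA subrK invgM mulgA.
by apply: le_trans (lp_sumD _ _) _; rewrite lp_sum_mulr.
Qed.

Lemma diff_psumV (G : groupType) (u : G) (f : G -> C) :
  diff_psum p u^-1%g f = diff_psum p u f.
Proof.
rewrite -[RHS](lp_sum_mulr u) -[RHS]lp_sumN.
by apply: eq_esum => g _; rewrite invgK mulgK opprB.
Qed.

Lemma diff_psum1 (G : groupType) (f : G -> C) : diff_psum p 1%g f = 0%E.
Proof.
by apply: esum1 => g _; rewrite invg1 mulg1 subrr normc0 powR0// gt_eqF.
Qed.

Lemma diff_psum_ge0 (G : groupType) (u : G) (f : G -> C) : (0 <= diff_psum p u f)%E.
Proof. exact: lp_sum_ge0. Qed.

Lemma diff_psum_le_lp_sum (G : groupType) (u : G) (f : G -> C) :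
  (diff_psum p u f <= (2 `^ p * 2)%:E * lp_sum f)%E.
Proof.
have -> : diff_psum p u f = lp_sum ((fun g => f (g * u^-1)%g) \+ (fun g => - f g))%R by [].
apply: le_trans (lp_sumD _ _) _.
by rewrite lp_sum_mulr lp_sumN EFinM -muleA mule_natl mule2n.
Qed.

Lemma diff_psum_ge_term (G : groupType) (u g : G) (f : G -> C) :
  ((normc (f (g * u^-1)%g - f g) `^ p)%:E <= diff_psum p u f)%E.
Proof.
apply: esum_ge; exists [set g]; first by split.
by rewrite fsbig_set1.
Qed.

End LpSum.

(** * Dirichlet energy and its control of displacements *)

Section Energy.
Local Open Scope classical_set_scope.
Context {R : realType} (p : R).
Hypothesis p1 : 1 < p.
Local Notation C := R[i].
Let p0 : 0 < p. Proof. exact: lt_trans p1. Qed.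

Definition edge_energy (G : groupType) (S : {fset G}) (f : G -> C) : \bar R :=
  (\sum_(s <- S) diff_psum p s f)%E.

(* The p-th power of [Dp_norm], which avoids extended-real roots. *)
Definition Dp_energy (G : groupType) (S : {fset G}) (f : G -> C) : \bar R :=
  (edge_energy S f + (normc (f 1%g) `^ p)%:E)%E.

Section OneGroup.
Context {G : groupType} (S : {fset G}).
Implicit Type f : G -> C.

Lemma edge_energy_ge0 f : (0 <= edge_energy S f)%E.
Proof. by apply: sume_ge0 => s _; exact: diff_psum_ge0. Qed.

Lemma Dp_energy_ge0 f : (0 <= Dp_energy S f)%E.
Proof. by rewrite adde_ge0 ?edge_energy_ge0// lee_fin powR_ge0. Qed.

Lemma edge_energy_le_Dp f : (edge_energy S f <= Dp_energy S f)%E.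
Proof. by rewrite leeDl// lee_fin powR_ge0. Qed.

Lemma Dp_energyE f : Dp p S f <-> (Dp_energy S f < +oo)%E.
Proof.
split=> [fD|fE s sS].
  rewrite lte_add_pinfty ?ltry// /edge_energy big_seq.
  by apply: lte_sum_pinfty => s; exact: fD.
apply: le_lt_trans fE; apply: le_trans (edge_energy_le_Dp _).
rewrite /edge_energy (big_rem s)//= leeDl//.
by apply: sume_ge0 => t _; exact: diff_psum_ge0.
Qed.

Lemma Dp_norm_lt f (e : R) : 0 < e ->
  (Dp_norm p S f < e%:E)%E = (Dp_energy S f < (e `^ p)%:E)%E.
Proof.
move=> e0; rewrite /Dp_norm /Dp_seminorm -/(edge_energy S f).
rewrite -poweRrM mulVf ?gt_eqF// poweRe1 ?edge_energy_ge0//.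
rewrite -/(Dp_energy S f).
have := Dp_energy_ge0 f; case: (Dp_energy S f) => [r| |]//; last first.
  by move=> _; rewrite poweRyr ?invr_eq0 ?gt_eqF// !ltNge !leey.
rewrite lee_fin => r0; rewrite poweR_EFin !lte_fin.
apply/idP/idP => [|re].
  move/(@gt0_ltr_powR _ p p0) => /(_ _ _).
  rewrite !nnegrE powR_ge0 ltW// -powRrM mulVf ?gt_eqF// powRr1//.
  exact.
rewrite -(powRr1 (ltW e0)) -(@mulfV _ p) ?gt_eqF// powRrM.
by rewrite gt0_ltr_powR ?invr_gt0// nnegrE ?powR_ge0.
Qed.

Lemma Dp_closureP (A : set (G -> C)) f : Dp_closure p S A f <->
  Dp p S f /\ forall e : R, 0 < e ->
    exists2 h, A h & (Dp_energy S (f - h)%R < e%:E)%E.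
Proof.
split=> -[fD fA]; split=> // e e0.
  have [h Ah fh] := fA (e `^ p^-1) (powR_gt0 _ e0); exists h => //.
  by move: fh; rewrite Dp_norm_lt ?powR_gt0// -powRrM mulVf ?gt_eqF// powRr1// ltW.
have [h Ah fh] := fA (e `^ p) (powR_gt0 _ e0); exists h => //.
by rewrite Dp_norm_lt.
Qed.

Hypothesis genS : generates S.

(* The [u] satisfying such a bound form a subgroup containing [S]. *)
Lemma diff_psum_le_energy (u : G) : exists2 K : R, 0 <= K &
  forall f, (diff_psum p u f <= K%:E * edge_energy S f)%E.
Proof.
pose good u := exists2 K : R, 0 <= K &
  forall f, (diff_psum p u f <= K%:E * edge_energy S f)%E.
pose K : {pred G} := [pred u | `[< good u >]].
suff /genS gK : group_closed K.
  have /gK/(_ u)/asboolP// : {subset S <= K}.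
  move=> s sS; apply/asboolP; exists 1 => // f.
  rewrite mul1e /edge_energy (big_rem s)//= leeDl//.
  by apply: sume_ge0 => t _; exact: diff_psum_ge0.
split.
  apply/asboolP; exists 0 => // f.
  by rewrite diff_psum1// mul0e.
move=> v w /asboolP[a a0 va] /asboolP[b b0 wb]; apply/asboolP.
exists (2 `^ p * (a + b)); first by rewrite mulr_ge0 ?powR_ge0 ?addr_ge0.
move=> f; apply: le_trans (diff_psumM p1 _ _ _) _.
rewrite diff_psumV EFinM -muleA; apply: lee_wpmul2l; first by rewrite lee_fin powR_ge0.
by rewrite EFinD ge0_muleDl ?lee_fin// leeD.
Qed.

Lemma sum_diff_psum_le_energy (F : seq G) : exists2 K : R, 0 <= K &
  forall f, (\sum_(u <- F) diff_psum p u f <= K%:E * edge_energy S f)%E.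
Proof.
elim: F => [|u F [K K0 HK]].
  by exists 0 => // f; rewrite big_nil mul0e.
have [L L0 HL] := diff_psum_le_energy u.
exists (L + K); first exact: addr_ge0.
by move=> f; rewrite big_cons EFinD ge0_muleDl ?lee_fin// leeD.
Qed.

(** Write [f u] as [f 1] plus a difference; up to sign, that difference is the term at [g = u] of
    [diff_psum p u f]. *)
Lemma eval_le_Dp_energy (u : G) : exists2 K : R, 0 <= K &
  forall f, ((normc (f u) `^ p)%:E <= K%:E * Dp_energy S f)%E.
Proof.
have [K K0 HK] := diff_psum_le_energy u.
exists (2 `^ p * (K + 1)); first by rewrite mulr_ge0 ?powR_ge0 ?addr_ge0.
move=> f; rewrite EFinM -muleA.
rewrite -[f u](subrK (f 1%g)).
have := normc_powRD p1 (f u - f 1%g) (f 1%g).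
rewrite -lee_fin => /le_trans; apply.
rewrite -normcN opprB EFinM lee_wpmul2l ?lee_fin ?powR_ge0//.
rewrite !EFinD ge0_muleDl ?lee_fin// leeD//; last first.
  by rewrite mul1e leeDr// edge_energy_ge0.
apply: le_trans (le_trans (HK f) _); last first.
  by rewrite lee_wpmul2l ?lee_fin// edge_energy_le_Dp.
by have := diff_psum_ge_term p u u f; rewrite mulgV.
Qed.

(** For each [x], the displacement [u] from [psi x] to [phi x] is in [F] and [psi x = phi x * u^-1],
    so the term on the left occurs among those on the right. *)
Lemma lp_sum_disp_le (X : choiceType) (F : seq G) (phi psi : X -> G) (f : G -> C) :
  (forall x, ((psi x)^-1 * phi x)%g \in F) ->
  (lp_sum p (fun x => f (psi x) - f (phi x))%R <=
   \sum_(u <- F) \esum_(x in [set: X]) (normc (f (phi x * u^-1)%g - f (phi x))%R `^ p)%:E)%E.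
Proof.
move=> HF; rewrite -esum_sum; last by move=> *; rewrite lee_fin powR_ge0.
apply: le_esum => x _; rewrite (big_rem _ (HF x))/= invgM invgK mulVKg.
by rewrite leeDl// sume_ge0// => u _; rewrite lee_fin powR_ge0.
Qed.

Lemma lp_sum_near_id (theta : G -> G) f : near_id theta -> Dp p S f ->
  (lp_sum p (fun g => f (theta g) - f g)%R < +oo)%E.
Proof.
move=> [F HF] /Dp_energyE fD.
have [K K0 HK] := sum_diff_psum_le_energy F.
apply: (le_lt_trans (lp_sum_disp_le _ HF)).
apply: (le_lt_trans (HK f)).
rewrite lte_mul_pinfty ?lee_fin//.
by apply: le_lt_trans fD; exact: edge_energy_le_Dp.
Qed.

Lemma Dp_energy_le_lp_sum : exists2 K : R, 0 < K &
  forall f, (Dp_energy S f <= K%:E * lp_sum p f)%E.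
Proof.
exists ((size S)%:R * (2 `^ p * 2) + 1); first by rewrite ltr_wpDl// !mulr_ge0 ?powR_ge0.
move=> f; rewrite EFinD ge0_muleDl ?lee_fin ?mulr_ge0 ?powR_ge0//; apply: leeD.
  rewrite EFinM -muleA /edge_energy; elim: (enum_fset S) => [|s r IHr].
    by rewrite big_nil mul0e.
  rewrite big_cons /= -natr1 addrC EFinD ge0_muleDl ?lee_fin// mul1e leeD//.
  exact: diff_psum_le_lp_sum.
rewrite mul1e; apply: esum_ge; exists [set 1%g]; first by split.
by rewrite fsbig_set1.
Qed.

(** Truncations of [f] to finite sets converge to [f] in p-sum, which dominates the energy. *)
Lemma lp_sum_Dp_closure f : (lp_sum p f < +oo)%E ->
  Dp_closure p S Defs.finite_support f.
Proof.
move=> ffin; have [K K0 HK] := Dp_energy_le_lp_sum.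
apply/Dp_closureP; split.
  by apply/Dp_energyE; rewrite (le_lt_trans (HK f))// lte_mul_pinfty ?lee_fin// ltW.
move=> e e0.
have [g|X finX Xe] := esum_tail_lt (divr_gt0 e0 K0) _ ffin.
  by rewrite lee_fin powR_ge0.
exists (fun g => if g \in X then f g else 0).
  apply: sub_finite_set finX => g /=.
  by case: ifPn => [|_]; rewrite ?inE.
apply: (le_lt_trans (HK _)).
rewrite muleC -lte_pdivlMr//; apply: le_lt_trans Xe.
rewrite [leRHS]esum_mkcond; apply: le_esum => g _ /=.
change ((normc (f g - (if g \in X then f g else 0))%R `^ p)%:E <=
  (if g \in ~` X then (normc (f g) `^ p)%:E else 0))%E.
rewrite in_setC; case: (g \in X) => /=; last by rewrite subr0.
by rewrite subrr normc0 powR0// gt_eqF.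
Qed.

End OneGroup.

(** * Composition with a coarse proper map *)

Section Pullback.
Context {G H : groupType} (S : {fset G}) (T : {fset H}) (phi : G -> H).
Hypotheses (genT : generates T) (phiC : coarse_map phi) (phiP : proper_map phi).

(* [sec] picks a point in each fibre; the cells [B u] of fixed displacement from it cover [G]
   and meet each fibre at most once. *)
Lemma esum_comp_le : exists n : nat, forall a : H -> \bar R,
  (forall h, 0 <= a h)%E ->
  (\esum_(g in [set: G]) a (phi g) <= n%:R%:E * \esum_(h in [set: H]) a h)%E.
Proof.
have [F HF] := phiP [:: 1%g].
exists (size F) => a a0.
have /choice[sec Hsec] h : exists g, (exists g', phi g' = h) -> phi g = h.
  have [[g gh]|nh] := pselect (exists g, phi g = h); first by exists g.
  by exists 1%g.
pose B u : set G := [set g | ((sec (phi g))^-1 * g)%g = u].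
apply: (@le_trans _ _ (\sum_(u <- F) \esum_(g in B u) a (phi g))%E).
  under eq_bigr do rewrite esum_mkcond.
  rewrite -esum_sum; last by move=> g u _ _; case: ifP.
  apply: le_esum => g _.
  have gF : ((sec (phi g))^-1 * g)%g \in F.
    by apply: HF; rewrite Hsec ?mulVg ?mem_head//; exists g.
  rewrite (big_rem _ gF)/= mem_set// leeDl// sume_ge0// => u _.
  by case: ifP.
have Bsum u : (\esum_(g in B u) a (phi g) <= \esum_(h in [set: H]) a h)%E.
  apply: esum_comp_inj_le => // x y; rewrite !inE /B /= => xu yu xy.
  by apply: (mulgI (sec (phi x))^-1%g); rewrite xu xy.
have A0 : (0 <= \esum_(h in [set: H]) a h)%E by exact: esum_ge0.
elim: F {HF} => [|u F IHF]; first by rewrite big_nil mul0e.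
by rewrite big_cons /= -natr1 addrC EFinD ge0_muleDl ?lee_fin// mul1e leeD.
Qed.

(** Coarseness turns an edge of [G] into a displacement from a finite set in [H]; the fibre bound
    [n] turns the sum over [G] into one over [H]. *)
Lemma edge_energy_comp_le : exists2 K : R, 0 <= K & forall f : H -> C,
  (edge_energy S (f \o phi) <= K%:E * edge_energy T f)%E.
Proof.
have [n Hn] := esum_comp_le.
rewrite /edge_energy; elim: (enum_fset S) => [|s r [K K0 HK]].
  by exists 0 => // f; rewrite big_nil mul0e.
have [F HF] := phiC [:: s].
have [L L0 HL] := sum_diff_psum_le_energy genT F.
exists (n%:R * L + K); first by rewrite addr_ge0// mulr_ge0.
move=> f; rewrite big_cons EFinD ge0_muleDl ?lee_fin ?mulr_ge0//.
apply: leeD => //.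
apply: (le_trans (@lp_sum_disp_le _ _ F phi (fun g => phi (g * s^-1)%g) f _)).
  by move=> g; apply: HF; rewrite invgM invgK mulgVK mem_head.
rewrite EFinM -muleA.
apply: (@le_trans _ _ (\sum_(u <- F) n%:R%:E * diff_psum p u f)%E).
  apply: lee_sum => u _.
  by apply: (Hn (fun h => (normc (f (h * u^-1)%g - f h) `^ p)%:E)) => h; rewrite lee_fin powR_ge0.
rewrite -ge0_sume_distrr; last by move=> u _; exact: diff_psum_ge0.
by rewrite lee_wpmul2l ?lee_fin.
Qed.

Lemma Dp_energy_comp_le : exists2 K : R, 0 < K & forall f : H -> C,
  (Dp_energy S (f \o phi) <= K%:E * Dp_energy T f)%E.
Proof.
have [K K0 HK] := edge_energy_comp_le.
have [L L0 HL] := eval_le_Dp_energy genT (phi 1%g).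
(* [K] bounds the edge terms and [L] the value at [phi 1]; adding 1 makes the constant positive, so
   that one can divide by it. *)
exists (K + L + 1); first by rewrite ltr_wpDl// addr_ge0.
move=> f; rewrite !EFinD !ge0_muleDl ?adde_ge0 ?lee_fin//.
apply: lee_paddr; first by rewrite mul1e Dp_energy_ge0.
apply: leeD (HL f); apply: le_trans (HK f) _.
by rewrite lee_wpmul2l ?lee_fin// edge_energy_le_Dp.
Qed.

Lemma Dp_comp (f : H -> C) : Dp p T f -> Dp p S (f \o phi).
Proof.
move=> /Dp_energyE fD; apply/Dp_energyE.
have [K K0 HK] := Dp_energy_comp_le.
by rewrite (le_lt_trans (HK f))// lte_mul_pinfty ?lee_fin// ltW.
Qed.

(** The support is a finite union of fibres, and a fibre through [x] lies in the finite translate of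
    [F] by [x]. *)
Lemma finite_support_comp (f : H -> C) :
  Defs.finite_support f -> Defs.finite_support (f \o phi).
Proof.
move=> ffin; rewrite /Defs.finite_support /= comp_preimage.
rewrite (_ : phi @^-1` _ = \bigcup_(h in f @^-1` [set~ 0]) phi @^-1` [set h]); last first.
  apply/seteqP; split=> [g gf|g [h + /= gh]]; first by exists (phi g).
  by rewrite -gh.
apply: bigcup_finite => // h _.
have [F HF] := phiP [:: 1%g].
have [[x xh]|nh] := pselect (exists x, phi x = h); last first.
  rewrite (_ : _ @^-1` _ = set0) //.
  by apply/seteqP; split=> // x xh; apply: nh; exists x.
apply: (@sub_finite_set _ _ [set` [seq (x * u)%g | u <- F]]) => // y /= yh.
apply/mapP; exists (x^-1 * y)%g; last by rewrite mulVKg.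
by apply: HF; rewrite xh yh mulVg mem_head.
Qed.

Lemma Dp_closure_comp (f : H -> C) : Dp_closure p T Defs.finite_support f ->
  Dp_closure p S Defs.finite_support (f \o phi).
Proof.
move=> /Dp_closureP[fD fA]; apply/Dp_closureP; split; first exact: Dp_comp.
move=> e e0; have [K K0 HK] := Dp_energy_comp_le.
have [h hfin fh] := fA (e / K) (divr_gt0 e0 K0).
exists (h \o phi); first exact: finite_support_comp.
apply: (le_lt_trans (HK (f - h))).
by rewrite muleC -lte_pdivlMr.
Qed.

End Pullback.
End Energy.

(** * Characters and the harmonic boundary *)

Section Characters.
Local Open Scope classical_set_scope.
Context {R : realType} (p : R) (p1 : 1 < p).
Local Notation C := R[i].

Lemma continuous_prod_topology {I : eqType} {K : I -> topologicalType}
    {X : topologicalType} (F : X -> prod_topology K) :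
  (forall i, continuous (fun x => F x i)) -> continuous F.
Proof.
move=> cF x; apply/cvg_sup => i.
exact: (@continuous_comp_initial _ _ _ (fun f : prod_topology K => f i) F (cF i) x).
Qed.

(** Used to see that a pulled back character is nonzero: composition with [phi] preserves the
    unit. *)
Lemma Sp1 (G : groupType) (S : {fset G}) (tau : BDp p1 S -> C) :
  Sp p1 S tau -> tau 1 != 0.
Proof.
move=> [_ tauM [f]]; apply: contra_neq => tau1.
by rewrite -[f]mulr1 tauM tau1 mulr0.
Qed.

Lemma SpB (G : groupType) (S : {fset G}) (tau : BDp p1 S -> C) (f g : BDp p1 S) :
  Sp p1 S tau -> tau (f - g) = tau f - tau g.
Proof.
by move=> [tauL _ _]; rewrite addrC -scaleN1r tauL mulN1r addrC.
Qed.

Lemma indicator_Dp_closure (G : groupType) (S : {fset G}) (h : G) :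
  Dp_closure p S Defs.finite_support (fun g => (g == h)%:R : C).
Proof.
apply: lp_sum_Dp_closure => //.
apply: (@le_lt_trans _ _ (\esum_(g in [set h]) 1%:E)%E); last by rewrite esum_set1// ltry.
rewrite [leRHS]esum_mkcond; apply: le_esum => g _; rewrite in_set1.
have p0 : 0 < p by exact: lt_trans p1.
by case: (g == h); rewrite ?normc1 ?powR1// normc0 powR0// gt_eqF.
Qed.

Definition vanishes_on_closure (G : groupType) (S : {fset G}) (x : Sp p1 S) : Prop :=
  forall f : BDp p1 S, Dp_closure p S Defs.finite_support f -> gelfand f x = 0.

(* The first condition in [harmonic_boundary] is redundant: the evaluation at [h] does not
   vanish on the indicator of [h]. *)
Lemma harmonic_boundaryP (G : groupType) (S : {fset G}) (x : Sp p1 S) :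
  harmonic_boundary p1 S x <-> vanishes_on_closure x.
Proof.
split=> [[]//|xv]; split=> // -[h _ hx].
have hB : (fun g => (g == h)%:R : C) \in BDp_pred p1 S.
  rewrite inE; split; first by case: (indicator_Dp_closure S h).
  by exists 1 => g; case: (g == h); rewrite ?normc0 ?normc1.
have := xv (MkBDp hB) (indicator_Dp_closure S h).
by rewrite -hx /gelfand /= eqxx => /eqP; rewrite oner_eq0.
Qed.

(** * The dual map between boundaries *)

Section Pullback.
Context {G H : groupType} (S : {fset G}) (T : {fset H}) (phi : G -> H).
Hypotheses (genT : generates T) (phiC : coarse_map phi) (phiP : proper_map phi).

Lemma BDp_comp_subproof (f : BDp p1 T) : f \o phi \in BDp_pred p1 S.
Proof.
case: f => f /= /[!inE] -[fD [M fM]].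
by split; [exact: Dp_comp fD|exists M => g; exact: fM].
Qed.

Definition BDp_comp (f : BDp p1 T) : BDp p1 S := MkBDp (BDp_comp_subproof f).

Lemma Sp_comp_subproof (x : Sp p1 S) : Sp p1 T (fun f => set_val x (BDp_comp f)).
Proof.
have xS := set_valP x.
split=> [k f g|f g|].
- have [xL _ _] := xS; rewrite -xL; congr (set_val x _); exact/val_inj.
- have [_ xM _] := xS; rewrite -xM; congr (set_val x _); exact/val_inj.
- exists 1; rewrite (_ : BDp_comp 1 = 1); last exact/val_inj.
  exact: Sp1.
Qed.

Definition Sp_comp (x : Sp p1 S) : Sp p1 T := SigSub (mem_set (Sp_comp_subproof x)).

Lemma Sp_comp_boundary (x : harmonic_boundary p1 S) :
  harmonic_boundary p1 T (Sp_comp (set_val x)).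
Proof.
have /harmonic_boundaryP xv := set_valP x.
by apply/harmonic_boundaryP => f fcl;
  exact: (xv (BDp_comp f) (Dp_closure_comp p1 S genT phiC phiP fcl)).
Qed.

Definition boundary_map (x : harmonic_boundary p1 S) : harmonic_boundary p1 T :=
  SigSub (mem_set (Sp_comp_boundary x)).

(** After unfolding the two subspace topologies, the coordinate at [f] of the image is the
    coordinate of [x] at [BDp_comp f], a continuous projection. *)
Lemma boundary_map_continuous : continuous boundary_map.
Proof.
apply: continuous_comp_initial; apply: continuous_comp_initial.
apply: continuous_prod_topology => f.
have projC := @proj_continuous _ (fun _ : BDp p1 S => C^o : topologicalType) (BDp_comp f).
have valC (x : harmonic_boundary p1 S) :
    {for x, continuous (set_val \o set_val : _ -> {ptws BDp p1 S -> C^o})}.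
  by apply: continuous_comp; exact: initial_continuous.
by move=> x; exact: continuous_comp (valC x) (projC _).
Qed.

End Pullback.

Lemma boundary_mapK (G H : groupType) (S : {fset G}) (T : {fset H})
    (phi : G -> H) (psi : H -> G) (genS : generates S) (genT : generates T)
    (phiC : coarse_map phi) (phiP : proper_map phi)
    (psiC : coarse_map psi) (psiP : proper_map psi) :
  near_id (psi \o phi) ->
  cancel (@boundary_map _ _ S T phi genT phiC phiP)
         (@boundary_map _ _ T S psi genS psiC psiP).
Proof.
move=> nid x; apply/val_inj/val_inj/funext => f /=.
have /harmonic_boundaryP xv := set_valP x.
pose f' := BDp_comp S genT phiC phiP (BDp_comp T genS psiC psiP f).
(* By linearity it remains to see that [x] kills [f' - f], where [f'] is [f] composed with
   [psi \o phi]; this difference is p-summable. *)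
apply: subr0_eq; rewrite -[LHS](SpB f' f (set_valP (set_val x))).
apply/(xv (f' - f))/lp_sum_Dp_closure => //=.
apply: (lp_sum_near_id p1 genS nid).
by case: (f) => ? /= /[!inE] -[].
Qed.

End Characters.

Theorem theorem2p3 (R : realType) (p : R) (p1 : 1 < p) (G H : groupType)
    (S : {fset G}) (T : {fset H})
    (genS : symmetric_generating S) (genT : symmetric_generating T)
    (roughGH : exists phi : G -> H,
       rough_isometry (word_dist R S) (word_dist R T) phi) :
  homeomorphic (harmonic_boundary p1 S) (harmonic_boundary p1 T).
Proof.
have [phi phiR] := roughGH; have [_ gS] := genS; have [_ gT] := genT.
have [psi [[phiC phiP] [psiC psiP] npsi nphi]] :=
  rough_isometry_coarse_inverse gS gT phiR.
exists (boundary_map gT phiC phiP), (boundary_map gS psiC psiP).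
by split; first [exact: boundary_map_continuous | exact: boundary_mapK].
Qed.
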